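(* Suppose that $f$ is concave in $\Gamma$ and that $f_i(\lambda)\ge0$ in $\Gamma$ for all $1\le i\le n$. Let $\sup_{\partial\Gamma}f<\underline A<\overline A<\sup_\Gamma f$ and suppose that for some constant $K\ge0$, $$\sum_{i=1}^n f_i(\lambda)\lambda_i\ \ge\ -K\sum_{i=1}^n f_i(\lambda)\qquad\text{for all }\lambda\in\Gamma\text{ with }\underline A\le f(\lambda)\le\overline A .$$ Then there is a positive constant $\theta$ depending on $K,\underline A,\overline A$ such that, for all $\lambda\in\Gamma$ with $\underline A\le f(\lambda)\le\overline A$ and all $1\le i\le n$, $$f_i(\lambda)\ \ge\ \theta\Big(1+\sum_{j=1}^n f_j(\lambda)\Big)\quad\text{if }\lambda_i\le -K .$$ In particular, if $K=0$, i.e. $\sum_{i=1}^n f_i(\lambda)\lambda_i\ge0$ for $\underline A\le f(\lambda)\le\overline A$, then for such $\lambda$ $$f_i(\lambda)\ \ge\ \theta\Big(1+\sum_{j=1}^n f_j(\lambda)\Big)\quad\text{if }\lambda_i\le0 .$$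
   Context: $f$ is a smooth symmetric function on an open symmetric convex cone $\Gamma\subset\mathbb{R}^n$ with vertex at the origin and nonempty boundary, containing the positive cone $\Gamma_n=\{\lambda\in\mathbb{R}^n:\ \lambda_i>0\ \forall i\}$. Write $f_i=\partial f/\partial\lambda_i$. Convention: $\sup_{\partial\Gamma}f=\sup_{\lambda_0\in\partial\Gamma}\limsup_{\lambda\to\lambda_0,\ \lambda\in\Gamma}f(\lambda)$. The pair $(f,\Gamma)$ is fixed; ''$\theta$ depends on $K,\underline A,\overline A$'' means $\theta$ is uniform in $\lambda$ and $i$. *)

(* Defs.v *)
From mathcomp Require Export all_boot all_order all_algebra fingroup perm.
From mathcomp Require Export all_classical all_reals all_analysis.

Set Implicit Arguments.
Unset Strict Implicit.
Unset Printing Implicit Defensive.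

Export Order.TTheory GRing.Theory Num.Theory.
Export numFieldNormedType.Exports.

Global Open Scope classical_set_scope.
Global Open Scope ring_scope.

Definition partial (R : realType) (n : nat) (f : 'rV[R]_n -> R) (i : 'I_n)
    (x : 'rV[R]_n) : R :=
  'D_(delta_mx ord0 i) f x.

Definition iter_partial (R : realType) (n : nat) (f : 'rV[R]_n -> R)
    (s : seq 'I_n) : 'rV[R]_n -> R :=
  foldr (fun i g => partial g i) f s.

(* C^oo on the open set U: partial derivatives of all orders exist and are
   continuous at the points of U. As U is open, only the values of f on U
   matter. *)
Definition smooth_on (R : realType) (n : nat) (U : set 'rV[R]_n)
    (f : 'rV[R]_n -> R) : Prop :=
  forall (s : seq 'I_n) (x : 'rV[R]_n), U x ->
    {for x, continuous (iter_partial f s)} /\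
    forall i : 'I_n, derivable (iter_partial f s) x (delta_mx ord0 i).

Definition concave_on (R : realType) (n : nat) (D : set 'rV[R]_n)
    (f : 'rV[R]_n -> R) : Prop :=
  convex_function D (fun x => - f x).

Definition symmetric_set (R : realType) (n : nat) (A : set 'rV[R]_n) : Prop :=
  forall (s : 'S_n) (x : 'rV[R]_n), A x -> A (col_perm s x).

Definition symmetric_on (R : realType) (n : nat) (A : set 'rV[R]_n)
    (f : 'rV[R]_n -> R) : Prop :=
  forall (s : 'S_n) (x : 'rV[R]_n), A x -> f (col_perm s x) = f x.

Definition positive_cone (R : realType) (n : nat) : set 'rV[R]_n :=
  [set x | forall i, 0 < x ord0 i].

Definition is_cone (R : realType) (n : nat) (A : set 'rV[R]_n) : Prop :=
  forall (t : R) (x : 'rV[R]_n), 0 < t -> A x -> A (t *: x).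

Definition boundary (T : topologicalType) (A : set T) : set T :=
  closure A `\` interior A.

Record admissible_cone (R : realType) (n : nat) (Gamma : set 'rV[R]_n) : Prop :=
  AdmissibleCone {
    cone_open : open Gamma;
    cone_symmetric : symmetric_set Gamma;
    cone_convex : convex_set Gamma;
    cone_scale : is_cone Gamma;
    cone_boundary : boundary Gamma !=set0;
    cone_positive : @positive_cone R n `<=` Gamma
  }.

Definition sup_boundary (R : realType) (n : nat) (Gamma : set 'rV[R]_n)
    (f : 'rV[R]_n -> R) : \bar R :=
  ereal_sup [set limf_esup (EFin \o f) (within Gamma (nbhs x0))
            | x0 in boundary Gamma].

Definition sup_on (R : realType) (n : nat) (Gamma : set 'rV[R]_n)
    (f : 'rV[R]_n -> R) : \bar R :=
  ereal_sup [set (f x)%:E | x in Gamma].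

(* Main.v *)
Require Import Defs.
From mathcomp Require Import ring lra.

(** Write [f_j] for the partial derivatives and call band the set of points
    of the cone where [a <= f <= b]. On the band the hypothesis says that
    [sum f_j (x_j + K) >= 0].

    Comparing the tangent plane at [x] with one fixed point where [f > b] gives
    a positive lower bound on [sum f_j] over the band ([sum_partial_ge]). So it
    suffices to bound [sum f_j] by a multiple of [f_i] when [x_i <= - K]. By
    symmetry and concavity, [f_j <= f_i] whenever [x_j > x_i]
    ([symmetric_partial_le]); the only derivatives to control are those in
    [J], the set of indices [j] other than [i] with [x_j <= - K].

    The key inequality ([gradient_pairing_ge0]) is that
    [sum f_j(x) (m_j + K) >= 0] for all [x] in the band and all [m] in the
    cone with [f m > a]. If [f m >= f x], it is the tangent plane at [x].
    Otherwise [m] lies in the band, and along the ray [m + t (m + K)] the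
    function [f] never drops below [a] ([homothety_ge]), while the sum is
    multiplied by [1 + t], so a negative sum would contradict the tangent
    plane at [x] for large [t]. If moreover
    [m_j < - K] for all [j] in [J], the inequality bounds the [f_j] with [j] in
    [J] by the others, hence by [f_i].

    Such an [m] is found from a point of the band with the same [i] and [J]:
    as [sum f_j > 0], one of its coordinates can be raised so as to
    increase [f]. At most one index of [J] is spoiled, and it can be
    exchanged with [i], whose coordinate is at most [- K] too
    ([nonpositive_witness]). Now [f > a] strictly, and a small shift of all
    coordinates makes those in [J] smaller than [- K]. As [m] depends only on
    the pair [(i, J)], finitely many constants occur ([partial_sum_le]). *)

Set Implicit Arguments.
Unset Strict Implicit.
Unset Printing Implicit Defensive.

(** * Tangent planes of concave functions *)

Lemma convex_setP (R : realType) (n : nat) (D : set 'rV[R]_n) (x y : 'rV[R]_n)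
    (t : R) :
  convex_set D -> D x -> D y -> 0 <= t <= 1 -> D (t *: x + (1 - t) *: y).
Proof.
move=> cD Dx Dy /andP[t0 t1]; apply/set_mem.
by have := cD x y (Itv01 t0 t1) (mem_set Dx) (mem_set Dy).
Qed.

Lemma concave_onP (R : realType) (n : nat) (D : set 'rV[R]_n)
    (f : 'rV[R]_n -> R) (x y : 'rV[R]_n) (t : R) :
  concave_on D f -> D x -> D y -> 0 <= t <= 1 ->
  t * f x + (1 - t) * f y <= f (t *: x + (1 - t) *: y).
Proof.
move=> cf Dx Dy /andP[t0 t1].
have := cf (Itv01 t0 t1) x y (mem_set Dx) (mem_set Dy).
by rewrite convRE /= /unstable.onem !mulrN -opprD lerN2.
Qed.

(** A one-sided bound from below on the derivative of [f] at [x] along [h].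
    Unlike the existence of directional derivatives, for a concave function it
    is inherited by sums of directions, so that the partial derivatives
    control all directions.
    Membership in [D] is included because the inheritance uses the midpoint
    of two such points. *)
Definition lower_slope (R : realType) (n : nat) (D : set 'rV[R]_n)
    (f : 'rV[R]_n -> R) (x h : 'rV[R]_n) (l : R) :=
  forall e, 0 < e -> exists2 d, 0 < d &
    forall t, 0 < t < d ->
      D (x + t *: h) /\ f x + t * (l - e) <= f (x + t *: h).

(** [x + t (h + k)] is the midpoint of [x + 2 t h] and [x + 2 t k]. *)
Lemma lower_slopeD (R : realType) (n : nat) (D : set 'rV[R]_n)
    (f : 'rV[R]_n -> R) (x h k : 'rV[R]_n) (l m : R) :
  convex_set D -> concave_on D f ->
  lower_slope D f x h l -> lower_slope D f x k m ->
  lower_slope D f x (h + k) (l + m).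
Proof.
move=> cD cf Hh Hk e e0.
have e20 : 0 < e / 2 by lra.
have [d d0 Hd] := Hh _ e20; have [d' d'0 Hd'] := Hk _ e20.
exists (Num.min d d' / 2) => [|t /andP[t0 tm]].
  by rewrite divr_gt0// lt_min d0.
have : 2 * t < Num.min d d' by lra.
rewrite lt_min => /andP[td td'].
have t20 : 0 < 2 * t by lra.
have [|Dh fh] := Hd (2 * t); first by rewrite t20.
have [|Dk fk] := Hd' (2 * t); first by rewrite t20.
have E : x + t *: (h + k) =
    2^-1 *: (x + (2 * t) *: h) + (1 - 2^-1) *: (x + (2 * t) *: k).
  by apply/rowP => j; rewrite !mxE; field.
have i2 : 0 <= (2^-1 : R) <= 1 by apply/andP; split; lra.
split; first by rewrite E; apply: convex_setP.
rewrite E; apply: le_trans (concave_onP cf Dh Dk i2); lra.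
Qed.

Lemma derivable_slope (R : realType) (n : nat) (f : 'rV[R]_n -> R)
    (x v : 'rV[R]_n) (e : R) :
  derivable f x v -> 0 < e ->
  exists2 d, 0 < d & forall s, `|s| < d ->
    `|f (x + s *: v) - f x - s * 'D_v f x| <= `|s| * e.
Proof.
move=> dv e0.
have /cvgrPdist_lt /(_ _ e0) [d /= d0 Hd] : h^-1 *: (f (h *: v + x) - f x)
   @[h --> 0^'] --> 'D_v f x by exact: dv.
exists d => // s sd; have [->|s0] := eqVneq s 0.
  by rewrite scale0r addr0 mul0r subr0 subrr normr0 mul0r.
have := Hd s; rewrite /= sub0r normrN => /(_ sd s0) /ltW.
have -> : f (x + s *: v) - f x - s * 'D_v f x =
    - s * ('D_v f x - s^-1 * (f (s *: v + x) - f x)).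
  by rewrite [x + _]addrC; field.
by rewrite normrM normrN ler_pM2l ?normr_gt0.
Qed.

Lemma lower_slope_derivable (R : realType) (n : nat) (D : set 'rV[R]_n)
    (f : 'rV[R]_n -> R) (x v : 'rV[R]_n) (c : R) :
  open D -> D x -> derivable f x v ->
  lower_slope D f x (c *: v) (c * 'D_v f x).
Proof.
move=> oD Dx dv e e0.
have c1 : 0 < `|c| + 1 by rewrite ltr_wpDl.
have [d d0 Hd] := derivable_slope dv (divr_gt0 e0 c1).
have Dn : \forall t \near (0 : R), D (x + t *: (c *: v)).
  have : x + t *: (c *: v) @[t --> (0:R)] --> x + 0 *: (c *: v).
    apply: cvgD; first exact: cvg_cst.
    by apply: cvgZr_tmp; exact: cvg_id.
  by rewrite scale0r addr0; apply; exact: open_nbhs_nbhs.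
have [d' /= d'0 Hd'] := Dn.
exists (Num.min d' (d / (`|c| + 1))) => [|t /andP[t0]].
  by rewrite lt_min d'0/= divr_gt0.
rewrite lt_min => /andP[td' td]; split.
  by apply: Hd'; rewrite /= sub0r normrN gtr0_norm.
move: td; rewrite ltr_pdivlMr// => td.
have ct : `|t * c| <= t * (`|c| + 1).
  by rewrite normrM gtr0_norm// ler_pM2l// lerDl.
have := Hd (t * c) (le_lt_trans ct td).
rewrite scalerA ler_norml => /andP[+ _] => H.
have : `|t * c| * (e / (`|c| + 1)) <= t * e.
  apply: le_trans (ler_wpM2r _ ct) _; first by rewrite divr_ge0 ?ltW.
  by rewrite -mulrA [(_ + 1) * _]mulrC divfK// gt_eqF.
lra.
Qed.

(** Writing [h = x - y] in the canonical basis, the bounds along the axes add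
    up to a bound from below on [f (x + t h)] for small [t > 0]. Since [x] lies
    between [y] and [x + t h], concavity turns it into a bound from above on
    [f y]. *)
Lemma concave_tangent (R : realType) (n : nat) (D : set 'rV[R]_n)
    (f : 'rV[R]_n -> R) (x y : 'rV[R]_n) :
  open D -> convex_set D -> concave_on D f ->
  D x -> D y -> (forall j : 'I_n, derivable f x (delta_mx ord0 j)) ->
  f y <= f x + \sum_(j < n) partial f j x * (y ord0 j - x ord0 j).
Proof.
move=> oD cD cf Dx Dy df.
pose L (h : 'rV[R]_n) := \sum_(j < n) h ord0 j * partial f j x.
have Hh h : lower_slope D f x h (L h).
  rewrite [h in lower_slope _ _ _ h _]row_sum_delta.
  apply: (big_rec2 (lower_slope D f x)) => [e e0|j k l _ Hl].
    exists 1 => // t /andP[t0 _].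
    by rewrite scaler0 addr0 sub0r mulrN lerBlDl lerDr mulr_ge0// ltW.
  by apply: lower_slopeD => //; exact: lower_slope_derivable.
suff : f y - f x <= L (y - x).
  rewrite lerBlDl; congr (_ <= _ + _).
  by apply: eq_bigr => j _; rewrite !mxE mulrC.
apply/ler_addgt0Pr => e e0.
have [d d0 Hd] := Hh (x - y) _ e0.
(* [x] is the barycentre of [y] and [x + t (x - y)] with weight [s] on [y]. *)
have [t t0 td] : exists2 t, 0 < t & t < d by exists (d / 2); lra.
have [|Dt ft] := Hd t; first by rewrite t0.
have t1 : 0 < 1 + t by lra.
pose s := t / (1 + t).
have s01 : 0 <= s <= 1.
  apply/andP; split; first by apply: divr_ge0; lra.
  by rewrite /s ler_pdivrMr// mul1r; lra.
have := concave_onP cf Dy Dt s01.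
have -> : s *: y + (1 - s) *: (x + t *: (x - y)) = x.
  apply/rowP => j; rewrite !mxE /s; field; lra.
have -> : 1 - s = (1 + t)^-1 by rewrite /s; field; lra.
have LN : L (y - x) = - L (x - y).
  rewrite /L -sumrN; apply: eq_bigr => j _; rewrite !mxE; ring.
rewrite LN /s mulrAC -[(1 + t)^-1 * _]mulrC -mulrDl ler_pdivrMr// => H.
rewrite -(ler_pM2l t0); lra.
Qed.

Lemma smooth_on_derivable (R : realType) (n : nat) (D : set 'rV[R]_n)
    (f : 'rV[R]_n -> R) (x : 'rV[R]_n) (i : 'I_n) :
  smooth_on D f -> D x -> derivable f x (delta_mx ord0 i).
Proof. by move=> sf Dx; have [_] := sf [::] x Dx; exact. Qed.

Lemma smooth_on_continuous (R : realType) (n : nat) (D : set 'rV[R]_n)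
    (f : 'rV[R]_n -> R) (x : 'rV[R]_n) :
  smooth_on D f -> D x -> {for x, continuous f}.
Proof. by move=> sf Dx; have [] := sf [::] x Dx. Qed.

(** Exchanging the coordinates [i] and [j] keeps the value of [f], so the
    tangent plane at [x] lies above [f] there, which reads
    [0 <= (f_i - f_j) (x_j - x_i)]. *)
Lemma symmetric_partial_le (R : realType) (n : nat) (D : set 'rV[R]_n)
    (f : 'rV[R]_n -> R) (x : 'rV[R]_n) (i j : 'I_n) :
  open D -> convex_set D -> concave_on D f -> smooth_on D f ->
  symmetric_set D -> symmetric_on D f -> D x ->
  x ord0 i < x ord0 j -> partial f j x <= partial f i x.
Proof.
move=> oD cD cf sf sD syf Dx xij.
pose y := col_perm (tperm i j) x.
have Dy : D y by exact: sD.
have := concave_tangent oD cD cf Dx Dy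
  (fun k => smooth_on_derivable (i:=k) sf Dx).
have ij : j != i by apply: contraTneq xij => ->; rewrite ltxx.
rewrite syf// lerDl (bigD1 i)//= (bigD1 j)//= big1 => [|k /andP[ki kj]].
  rewrite addr0 !mxE tpermL tpermR => H.
  rewrite -subr_ge0 -(pmulr_lge0 _ (_ : 0 < x ord0 j - x ord0 i)) ?subr_gt0//.
  lra.
by rewrite !mxE tpermD 1?eq_sym// subrr mulr0.
Qed.

(** * Homotheties of the cone *)

Lemma cone_add (R : realType) (n : nat) (D : set 'rV[R]_n) (x y : 'rV[R]_n) :
  convex_set D -> is_cone D -> D x -> D y -> D (x + y).
Proof.
move=> cD kD Dx Dy.
have i2 : 0 <= (2^-1 : R) <= 1 by apply/andP; split; lra.
have -> : x + y = 2%:R *: (2^-1 *: x + (1 - 2^-1) *: y).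
  by apply/rowP => j; rewrite !mxE; field.
by apply: kD => //; exact: convex_setP.
Qed.

(** The case [c = 0], where the added vector is only on the boundary of the
    positive cone, has to be covered because [K] may vanish. *)
Lemma cone_shift (R : realType) (n : nat) (D : set 'rV[R]_n) (x : 'rV[R]_n)
    (c : R) :
  admissible_cone D -> 0 <= c -> D x -> D (x + const_mx c).
Proof.
move=> aD; rewrite le_eqVlt => /predU1P[<-|c0] Dx.
  by rewrite (_ : const_mx 0 = 0) ?addr0//; apply/rowP => j; rewrite !mxE.
apply: cone_add (cone_convex aD) (cone_scale aD) Dx _.
by apply: (cone_positive aD) => j; rewrite mxE.
Qed.

(** The homothety of ratio [1 + t] about the point whose coordinates all
    equal [- K]. The hypothesis on the band says that [f] does not decrease
    along its orbits as long as they stay in the band. *)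
Definition homothety (R : realType) (n : nat) (K t : R) (x : 'rV[R]_n) :=
  x + t *: (x + const_mx K).

Lemma homothety_in (R : realType) (n : nat) (D : set 'rV[R]_n) (x : 'rV[R]_n)
    (K t : R) :
  admissible_cone D -> 0 <= K -> 0 <= t -> D x -> D (homothety K t x).
Proof.
move=> aD K0 t0 Dx.
rewrite (_ : homothety K t x = (1 + t) *: x + const_mx (t * K)).
  apply: cone_shift => //; first exact: mulr_ge0.
  by apply: (cone_scale aD) => //; lra.
by apply/rowP => j; rewrite !mxE; ring.
Qed.

Lemma continuous_homothety (R : realType) (n : nat) (K : R) (x : 'rV[R]_n) :
  continuous (fun t => homothety K t x).
Proof.
move=> t; apply: cvgD; first exact: cvg_cst.
by apply: cvgZr_tmp; exact: cvg_id.
Qed.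

Definition band_condition (R : realType) (n : nat) (D : set 'rV[R]_n)
    (f : 'rV[R]_n -> R) (a b K : R) :=
  forall x, D x -> a <= f x <= b ->
    - K * \sum_(i < n) partial f i x <= \sum_(i < n) partial f i x * x ord0 i.

Lemma band_conditionP (R : realType) (n : nat) (D : set 'rV[R]_n)
    (f : 'rV[R]_n -> R) (a b K : R) (x : 'rV[R]_n) :
  band_condition D f a b K -> D x -> a <= f x <= b ->
  0 <= \sum_(i < n) partial f i x * (x ord0 i + K).
Proof.
move=> bc Dx fx; have := bc x Dx fx.
rewrite -subr_ge0 mulNr opprK mulr_sumr -big_split/=.
by under eq_bigr do rewrite [K * _]mulrC -mulrDr.
Qed.

(** If [f] fell below [f m] on the ray, it would take there a value strictly
    between [a] and [f m], by the intermediate value theorem. At such a point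
    the hypothesis on the band makes the direction towards [m] one of
    nonpositive slope, so the tangent plane forbids the larger value [f m].
    The strict inequality [a < f m] leaves room for the intermediate value. *)
Lemma homothety_ge (R : realType) (n : nat) (D : set 'rV[R]_n)
    (f : 'rV[R]_n -> R) (a b K t : R) (m : 'rV[R]_n) :
  admissible_cone D -> smooth_on D f -> concave_on D f -> 0 <= K ->
  band_condition D f a b K -> D m -> a < f m <= b -> 0 <= t ->
  f m <= f (homothety K t m).
Proof.
move=> aD sf cf K0 bc Dm /andP[am mb] t0; rewrite leNgt; apply/negP => fm.
pose g s := f (homothety K s m).
rewrite -/(g t) in fm.
have g0 : g 0 = f m by rewrite /g /homothety scale0r addr0.
have cg : {within `[0, t], continuous g}.
  apply: continuous_in_subspaceT => s; rewrite inE/= in_itv/= => /andP[s0 _].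
  apply: continuous_comp; first exact: continuous_homothety.
  by apply: smooth_on_continuous sf _; exact: homothety_in.
pose v := (Num.max a (g t) + f m) / 2.
have vm : Num.max a (g t) < f m by rewrite gt_max am.
have av : a <= Num.max a (g t) by rewrite le_max lexx.
have gv : g t <= Num.max a (g t) by rewrite le_max lexx orbT.
have [|s] := IVT t0 cg (v := v).
  rewrite g0 (min_idPr (ltW fm)) (max_idPl (ltW fm)) /v.
  by apply/andP; split; lra.
rewrite in_itv/= => /andP[s0 st] gs.
have Ds := homothety_in aD K0 s0 Dm.
have fs : a <= f (homothety K s m) <= b.
  by apply/andP; rewrite -/(g s) gs /v; split; lra.
have := concave_tangent (cone_open aD) (cone_convex aD) cf Ds Dm
  (fun k => smooth_on_derivable (i:=k) sf Ds).
rewrite -/(g s) gs.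
have -> : \sum_(j < n) partial f j (homothety K s m) *
    (m ord0 j - homothety K s m ord0 j) = - (s / (1 + s)) *
    \sum_(j < n) partial f j (homothety K s m) * (homothety K s m ord0 j + K).
  rewrite mulr_sumr; apply: eq_bigr => j _; rewrite !mxE; field; lra.
have : 0 <= s / (1 + s) * (\sum_(j < n) partial f j (homothety K s m) *
    (homothety K s m ord0 j + K)).
  by rewrite mulr_ge0 ?divr_ge0 ?(band_conditionP bc)//; lra.
rewrite /v; lra.
Qed.

(** * Estimates on the gradient *)

Lemma nonneg_of_affine_bound (R : realType) (c s : R) :
  (forall t, 0 <= t -> c <= (1 + t) * s) -> 0 <= s.
Proof.
move=> H; rewrite leNgt; apply/negP => s0.
have [c0|c0] := leP 0 c; first by have := H 0 (lexx _); lra.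
have ns : s != 0 by rewrite lt_eqF.
have := H (c / s) (ltW _); rewrite nmulr_rgt0// invr_lt0 => /(_ s0).
rewrite mulrDl divfK//; lra.
Qed.

(** When [f x <= f m] this is the tangent plane at [x]. Otherwise [m] lies in
    the band, and [f >= a] along the whole ray of homotheties of [m]; the
    tangent plane at [x] then bounds [1 + t] times the sum from below by
    [a - b] for every [t >= 0], and the sum cannot be negative. *)
Lemma gradient_pairing_ge0 (R : realType) (n : nat) (D : set 'rV[R]_n)
    (f : 'rV[R]_n -> R) (a b K : R) (x m : 'rV[R]_n) :
  admissible_cone D -> smooth_on D f -> concave_on D f -> 0 <= K ->
  band_condition D f a b K -> D x -> a <= f x <= b -> D m -> a < f m ->
  0 <= \sum_(j < n) partial f j x * (m ord0 j + K).
Proof.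
move=> aD sf cf K0 bc Dx fx Dm am.
have xK := band_conditionP bc Dx fx.
have tan y : D y -> f y - f x + \sum_(j < n) partial f j x * (x ord0 j + K)
    <= \sum_(j < n) partial f j x * (y ord0 j + K).
  move=> Dy; have := concave_tangent (cone_open aD) (cone_convex aD) cf Dx Dy
    (fun k => smooth_on_derivable (i:=k) sf Dx).
  have -> : \sum_(j < n) partial f j x * (y ord0 j + K) =
      \sum_(j < n) partial f j x * (y ord0 j - x ord0 j) +
      \sum_(j < n) partial f j x * (x ord0 j + K).
    by rewrite -big_split/=; apply: eq_bigr => j _; ring.
  lra.
have [xm|mx] := leP (f x) (f m); first by have := tan m Dm; lra.
have [fa fb] := andP fx.
apply: (@nonneg_of_affine_bound _ (a - b)) => t t0.
have fm : a < f m <= b by rewrite am/=; lra.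
have := tan _ (homothety_in aD K0 t0 Dm).
have := homothety_ge aD sf cf K0 bc Dm fm t0.
have -> : \sum_(j < n) partial f j x * (homothety K t m ord0 j + K) =
    (1 + t) * \sum_(j < n) partial f j x * (m ord0 j + K).
  by rewrite mulr_sumr; apply: eq_bigr => j _; rewrite !mxE; ring.
lra.
Qed.

(** The tangent plane at [x] must climb from at most [b] to [f y > b] at one
    fixed point [y], and by the hypothesis on the band this climb is at most
    [sum f_j (y_j + K)], whose weights [y_j + K] do not depend on [x]. *)
Lemma sum_partial_ge (R : realType) (n : nat) (D : set 'rV[R]_n)
    (f : 'rV[R]_n -> R) (a b K : R) :
  admissible_cone D -> smooth_on D f -> concave_on D f -> 0 <= K ->
  (forall x, D x -> forall i : 'I_n, 0 <= partial f i x) ->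
  (b%:E < sup_on D f)%E -> band_condition D f a b K ->
  exists2 c, 0 < c & forall x, D x -> a <= f x <= b ->
    c <= \sum_(j < n) partial f j x.
Proof.
move=> aD sf cf K0 mf bsup bc.
have [_ [y Dy <-] by_] := ereal_sup_gt bsup; rewrite lte_fin in by_.
pose M := 1 + \sum_(j < n) `|y ord0 j + K|.
have M0 : 0 < M by rewrite ltr_pwDl// sumr_ge0.
exists ((f y - b) / M) => [|x Dx /andP[ax xb]].
  by rewrite divr_gt0 ?subr_gt0.
have xK : 0 <= \sum_(j < n) partial f j x * (x ord0 j + K).
  by apply: (band_conditionP bc) => //; rewrite ax.
rewrite ler_pdivrMr//.
have := concave_tangent (cone_open aD) (cone_convex aD) cf Dx Dy
    (fun k => smooth_on_derivable (i:=k) sf Dx).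
have : \sum_(j < n) partial f j x * (y ord0 j - x ord0 j) +
   \sum_(j < n) partial f j x * (x ord0 j + K) <=
   (\sum_(j < n) partial f j x) * M.
  rewrite -big_split/= mulr_suml; apply: ler_sum => j _; rewrite -mulrDr.
  apply: ler_wpM2l; first exact: mf.
  have : y ord0 j + K <= M.
    apply: le_trans (ler_norm _) _; rewrite /M (bigD1 j)//= addrCA lerDl.
    by rewrite addr_ge0// sumr_ge0.
  lra.
lra.
Qed.

Lemma partial_gt0_raise (R : realType) (n : nat) (D : set 'rV[R]_n)
    (f : 'rV[R]_n -> R) (x : 'rV[R]_n) (k : 'I_n) :
  open D -> smooth_on D f -> D x -> 0 < partial f k x ->
  exists2 t, 0 < t &
    D (x + t *: delta_mx ord0 k) /\ f x < f (x + t *: delta_mx ord0 k).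
Proof.
move=> oD sf Dx fk.
have fk2 : 0 < partial f k x / 2 by lra.
have := lower_slope_derivable 1 oD Dx (smooth_on_derivable (i:=k) sf Dx) fk2.
rewrite scale1r mul1r => -[d d0 Hd].
have d20 : 0 < d / 2 by lra.
have [|Dy fy] := Hd (d / 2); first by rewrite d20; lra.
exists (d / 2) => //; split => //; apply: lt_le_trans fy.
rewrite ltrDl mulr_gt0// subr_gt0.
by rewrite -/(partial f k x); lra.
Qed.

Lemma shift_down (R : realType) (n : nat) (D : set 'rV[R]_n)
    (f : 'rV[R]_n -> R) (a : R) (x : 'rV[R]_n) :
  open D -> smooth_on D f -> D x -> a < f x ->
  exists2 e, 0 < e & D (x - const_mx e) /\ a < f (x - const_mx e).
Proof.
move=> oD sf Dx ax.
have cx : x + t *: const_mx (-1) @[t --> (0:R)] --> x.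
  rewrite -[X in _ --> X]addr0 -[X in _ --> x + X](scale0r (const_mx (-1))).
  apply: cvgD; first exact: cvg_cst.
  by apply: cvgZr_tmp; exact: cvg_id.
have nD : nbhs x D by exact: open_nbhs_nbhs.
have nf : nbhs x [set y | a < f y].
  have := @smooth_on_continuous _ _ _ _ _ sf Dx => /(_ [set z | a < z]); apply.
  by apply: open_nbhs_nbhs; split => //; exact: open_gt.
have /= [d /= d0 Hd] := cx _ (filterI nD nf).
have := Hd (d / 2); rewrite /= sub0r normrN gtr0_norm ?divr_gt0//.
move=> /(_ ltac:(lra)).
have -> : x + (d / 2) *: const_mx (-1) = x - const_mx (d / 2).
  by apply/rowP => j; rewrite !mxE; ring.
by exists (d / 2) => //; lra.
Qed.

(** Raising a coordinate [k] with [f_k > 0] increases [f] strictly. If [k]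
    belongs to [J], this may spoil the bound on that coordinate; exchanging
    [k] with the spare index [i], where the bound holds as well, moves the
    raised coordinate out of [J]. *)
Lemma nonpositive_witness (R : realType) (n : nat) (D : set 'rV[R]_n)
    (f : 'rV[R]_n -> R) (c : R) (x : 'rV[R]_n) (i : 'I_n) (J : {set 'I_n}) :
  open D -> smooth_on D f -> symmetric_set D -> symmetric_on D f ->
  D x -> 0 < \sum_(k < n) partial f k x ->
  (forall k, 0 <= partial f k x) ->
  i \notin J -> x ord0 i <= c -> (forall j, j \in J -> x ord0 j <= c) ->
  exists2 y, D y /\ f x < f y & forall j, j \in J -> y ord0 j <= c.
Proof.
move=> oD sf sD syf Dx f_gt0 f_ge0 iJ xi xJ.
have [k fk] : exists k, 0 < partial f k x.
  apply: contrapT => /forallNP H; move: f_gt0; rewrite big1 ?ltxx// => k _.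
  by apply/eqP; rewrite eq_le f_ge0// andbT leNgt; apply/negP.
have [t t0 [Dy fy]] := partial_gt0_raise oD sf Dx fk.
have [kJ|kJ] := boolP (k \in J); last first.
  exists (x + t *: delta_mx ord0 k) => // j jJ.
  rewrite !mxE eqxx/= (_ : j == k = false) ?mulr0 ?addr0 ?xJ//.
  by apply/negbTE; apply: contraNneq kJ => <-.
exists (col_perm (tperm i k) (x + t *: delta_mx ord0 k)).
  by rewrite syf//; split => //; exact: sD.
move=> j jJ; have ij : i != j by apply: contraNneq iJ => ->.
rewrite !mxE eqxx/=; have [->|jk] := eqVneq k j.
  have -> : tperm i j j == j = false by rewrite tpermR (negbTE ij).
  by rewrite tpermR mulr0 addr0.
by rewrite tpermD// eq_sym (negbTE jk) mulr0 addr0 xJ.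
Qed.

(** The constant must not depend on [x]; it is allowed to depend on [i] and on
    the set [J] of the other indices whose coordinates are at most [- K], which
    leaves finitely many cases. A single point [x0] of the given type yields a
    point [z] of [D] with [a < f z] and [z_j + K <= - e < 0] on [J]. Pairing
    its shift by [K] with the gradient at any [x] of the same type bounds the
    derivatives with index in [J] by the other ones, and these are at most
    [f_i], as [x_i] is minimal among the coordinates outside [J]. *)
Lemma partial_sum_le (R : realType) (n : nat) (D : set 'rV[R]_n)
    (f : 'rV[R]_n -> R) (a b K : R) (i : 'I_n) (J : {set 'I_n}) :
  admissible_cone D -> smooth_on D f -> symmetric_on D f -> concave_on D f ->
  (forall x, D x -> forall i : 'I_n, 0 <= partial f i x) ->
  (b%:E < sup_on D f)%E -> 0 <= K -> band_condition D f a b K ->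
  exists2 C, 0 <= C & forall x, D x -> a <= f x <= b -> x ord0 i <= - K ->
    [set j | (j != i) && (x ord0 j <= - K)]%SET = J ->
    \sum_(j < n) partial f j x <= C * partial f i x.
Proof.
move=> aD sf syf cf mf bsup K0 bc.
have [[x0 [Dx0 fx0 x0i x0J]]|nex] := pselect (exists x, [/\ D x,
    a <= f x <= b, x ord0 i <= - K &
    [set j | (j != i) && (x ord0 j <= - K)]%SET = J]); last first.
  by exists 0 => // x Dx fx xi xJ; case: nex; exists x.
have [c c0 sum_ge] := sum_partial_ge aD sf cf K0 mf bsup bc.
have iJ : i \notin J by rewrite -x0J inE eqxx.
have [j|y [Dy fy] yJ] :=
  nonpositive_witness (cone_open aD) sf (cone_symmetric aD) syf
    Dx0 (lt_le_trans c0 (sum_ge _ Dx0 fx0)) (mf x0 Dx0) iJ x0i.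
  by rewrite -x0J inE => /andP[].
have [e e0 [Dz az]] :=
  shift_down (cone_open aD) sf Dy (le_lt_trans (andP fx0).1 fy).
pose C := \sum_(j < n) `|y ord0 j + K|.
exists (C / e) => [|x Dx fx xi xJ].
  by rewrite divr_ge0 ?(ltW e0)// sumr_ge0.
rewrite mulrAC ler_pdivlMr//.
have := gradient_pairing_ge0 aD sf cf K0 bc Dx fx Dz az.
have -> : \sum_(j < n) partial f j x * ((y - const_mx e) ord0 j + K) =
    \sum_(j < n) partial f j x * (y ord0 j + K) -
    (\sum_(j < n) partial f j x) * e.
  rewrite mulr_suml -sumrB; apply: eq_bigr => j _; rewrite !mxE; ring.
rewrite subr_ge0 => /le_trans; apply.
rewrite mulr_suml; apply: ler_sum => j _; rewrite mulrC.
have fj0 := mf x Dx j.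
have [jJ|jJ] := boolP (j \in J).
  apply: (@le_trans _ _ 0); last by rewrite mulr_ge0 ?mf.
  by rewrite mulr_le0_ge0//; have := yJ j jJ; lra.
apply: le_trans (ler_wpM2r fj0 (ler_norm _)) _; apply: ler_wpM2l => //.
have [->//|ji] := eqVneq j i.
apply: symmetric_partial_le (cone_open aD) (cone_convex aD) cf sf
  (cone_symmetric aD) syf Dx _.
apply: le_lt_trans xi _; rewrite ltNge; apply: contra jJ => xj.
by rewrite -xJ inE ji.
Qed.

(** The constants of the finitely many types are added up, and the term [1] is
    absorbed with the positive lower bound on the sum of the derivatives. *)
Lemma partial_lower_bound (R : realType) (n : nat) (D : set 'rV[R]_n)
    (f : 'rV[R]_n -> R) (a b K : R) :
  admissible_cone D -> smooth_on D f -> symmetric_on D f -> concave_on D f ->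
  (forall x, D x -> forall i : 'I_n, 0 <= partial f i x) ->
  (b%:E < sup_on D f)%E -> 0 <= K -> band_condition D f a b K ->
  exists2 theta : R, 0 < theta &
    forall x, D x -> a <= f x <= b -> forall i : 'I_n, x ord0 i <= - K ->
      theta * (1 + \sum_(j < n) partial f j x) <= partial f i x.
Proof.
move=> aD sf syf cf mf bsup K0 bc.
have [c c0 sum_ge] := sum_partial_ge aD sf cf K0 mf bsup bc.
have /choice[C HC] : forall p : 'I_n * {set 'I_n}, exists C, 0 <= C /\
    forall x, D x -> a <= f x <= b -> x ord0 p.1 <= - K ->
    [set j | (j != p.1) && (x ord0 j <= - K)]%SET = p.2 ->
    \sum_(j < n) partial f j x <= C * partial f p.1 x.
  move=> [i J]; have [C] := partial_sum_le i J aD sf syf cf mf bsup K0 bc.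
  by exists C.
pose M := 1 + \sum_p C p.
have M0 : 0 < M by rewrite ltr_pwDl// sumr_ge0// => p _; have [] := HC p.
have c1 : 0 < 1 + c^-1 by rewrite ltr_pwDl// ltW// invr_gt0.
exists ((1 + c^-1) * M)^-1 => [|x Dx fx i xi].
  by rewrite invr_gt0 mulr_gt0.
rewrite mulrC ler_pdivrMr ?mulr_gt0//.
have S := sum_ge x Dx fx.
have one : 1 + \sum_(j < n) partial f j x <=
    (1 + c^-1) * \sum_(j < n) partial f j x.
  by rewrite mulrDl mul1r addrC lerD2l -ler_pdivrMl ?invr_gt0// invrK mulr1.
apply: le_trans one _; rewrite mulrCA ler_pM2l// mulrC.
pose p := (i, [set j | (j != i) && (x ord0 j <= - K)]%SET).
have [_ /(_ x Dx fx xi erefl) /le_trans] := HC p; apply.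
apply: ler_wpM2r; first exact: mf.
rewrite /M (bigD1 p)//= addrCA lerDl addr_ge0// sumr_ge0// => q _.
by have [] := HC q.
Qed.

Theorem theorem1p5 (R : realType) (n : nat) (Gamma : set 'rV[R]_n)
    (f : 'rV[R]_n -> R)
    (hGamma : admissible_cone Gamma)
    (hsmooth : smooth_on Gamma f)
    (hsym : symmetric_on Gamma f)
    (hconcave : concave_on Gamma f)
    (hmono : forall x, Gamma x -> forall i : 'I_n, 0 <= partial f i x)
    (a b : R)
    (ha : (sup_boundary Gamma f < a%:E)%E)
    (hab : a < b)
    (hb : (b%:E < sup_on Gamma f)%E) :
  (forall K : R, 0 <= K ->
    (forall x, Gamma x -> a <= f x <= b ->
       \sum_(i < n) partial f i x * x ord0 i
         >= - K * \sum_(i < n) partial f i x) ->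
    exists2 theta : R, 0 < theta &
      forall x, Gamma x -> a <= f x <= b ->
        forall i : 'I_n, x ord0 i <= - K ->
          partial f i x >= theta * (1 + \sum_(j < n) partial f j x))
  /\
  ((forall x, Gamma x -> a <= f x <= b ->
      \sum_(i < n) partial f i x * x ord0 i >= 0) ->
   exists2 theta : R, 0 < theta &
     forall x, Gamma x -> a <= f x <= b ->
       forall i : 'I_n, x ord0 i <= 0 ->
         partial f i x >= theta * (1 + \sum_(j < n) partial f j x)).
Proof.
split=> [K K0 bc|bc].
  exact: partial_lower_bound hGamma hsmooth hsym hconcave hmono hb K0 bc.
have bc0 : band_condition Gamma f a b 0.
  by move=> x Gx fx; rewrite oppr0 mul0r bc.
have [theta t0 H] := partial_lower_bound hGamma hsmooth hsym hconcave hmono hb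
  (lexx 0) bc0.
by exists theta => // x Gx fx i xi; apply: H => //; rewrite oppr0.
Qed.
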